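(* Let $\mathcal{C}$ be any subrecursive class that is closed under primitive recursive operations. Then $$(i)\;\;\mathcal{C}_{T\uparrow}\cap\mathcal{C}_D=\mathcal{C}_{g\uparrow}\qquad\text{and}\qquad(ii)\;\;\mathcal{C}_{T\downarrow}\cap\mathcal{C}_D=\mathcal{C}_{g\downarrow}.$$
   Context: All real numbers considered lie strictly between $0$ and $1$. A base is a natural number $b\geq 2$. Every irrational $\alpha\in(0,1)$ can be written uniquely as $\alpha=\sum_{i=1}^\infty \mathtt{D}_i b^{-k_i}$ with $\mathtt{D}_i\in\{1,\dots,b-1\}$ and $0<k_1<k_2<\cdots$. Set $\hat{A}^\alpha_b(0)=0$, $\hat{A}^\alpha_b(i)=\mathtt{D}_ib^{-k_i}$ for $i>0$, and $\check{A}^\alpha_b=\hat{A}^{1-\alpha}_b$. The general sum approximation from below of $\alpha$ is $\hat{G}^\alpha(b,n)=\hat{A}^\alpha_b(n)$ for $b\ge2$ and $0$ for $b<2$; from above it is $\check{G}^\alpha(b,n)=\check{A}^\alpha_b(n)$ for $b\ge 2$ and $0$ for $b<2$. A function $D:\mathbb{Q}\to\{0,1\}$ is a Dedekind cut of the real $\beta$ if $D(q)=0\iff q<\beta$. A function $\hat{T}:\mathbb{Q}\to\mathbb{Q}$ is a trace function from below for the irrational $\alpha$ if $q<\hat{T}(q)<\alpha$ for every rational $q<\alpha$; a function $\check{T}:\mathbb{Q}\to\mathbb{Q}$ is a trace function from above for $\alpha$ if $\alpha<\check{T}(q)<q$ for every rational $q>\alpha$. Rationals are coded into $\mathbb{N}$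 in a standard elementary way. A subrecursive class is an efficiently enumerable class of computable total functions; it is closed under primitive recursive operations if it contains all primitive recursive functions and every function primitive recursive in functions of the class is in the class. For such $\mathcal{C}$: $\mathcal{C}_D$ is the set of irrational numbers having a Dedekind cut in $\mathcal{C}$; $\mathcal{C}_{T\uparrow}$ (resp. $\mathcal{C}_{T\downarrow}$) is the set of irrational numbers having a trace function from below (resp. above) in $\mathcal{C}$; $\mathcal{C}_{g\uparrow}$ (resp. $\mathcal{C}_{g\downarrow}$) is the set of irrational numbers whose general sum approximation from below (resp. above) is in $\mathcal{C}$. *)

(* Defs.v *)
From mathcomp Require Import all_boot all_order all_algebra.
From mathcomp Require Import all_classical all_reals all_analysis.
Set Implicit Arguments.
Unset Strict Implicit.
Unset Printing Implicit Defensive.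
Import Order.TTheory GRing.Theory Num.Theory.
Import numFieldNormedType.Exports.

Definition nfun (k : nat) : Type := k.-tuple nat -> nat.

Definition fclass : Type := forall k : nat, nfun k -> Prop.

(** Recursion on the first argument:
    h (0, x) = f x and h (n.+1, x) = g (n, h (n, x), x). *)
Fixpoint natrec k (f : nfun k) (g : nfun k.+2) (x : k.-tuple nat) (n : nat) :=
  if n is m.+1 then g [tuple of m :: natrec f g x m :: x] else f x.

Inductive primrec_in (C : fclass) : forall k : nat, nfun k -> Prop :=
| PR_oracle k (f : nfun k) : C k f -> primrec_in C f
| PR_zero k : primrec_in C (fun _ : k.-tuple nat => 0)
| PR_succ : primrec_in C (fun x : 1.-tuple nat => (thead x).+1)
| PR_proj k (i : 'I_k) : primrec_in C (fun x : k.-tuple nat => tnth x i)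
| PR_comp m k (f : nfun m) (g : 'I_m -> nfun k) :
    primrec_in C f -> (forall i, primrec_in C (g i)) ->
    primrec_in C (fun x : k.-tuple nat => f [tuple g i x | i < m])
| PR_rec k (f : nfun k) (g : nfun k.+2) :
    primrec_in C f -> primrec_in C g ->
    primrec_in C (fun x : k.+1.-tuple nat =>
                    natrec f g [tuple of behead x] (thead x)).

Definition primrec k (f : nfun k) : Prop := primrec_in (fun _ _ => False) f.

Definition primrec_closed (C : fclass) : Prop :=
  (forall k (f : nfun k), primrec f -> C k f) /\
  (forall k (f : nfun k), primrec_in C f -> C k f).

Inductive mu_term : nat -> Type :=
| MuZero k : mu_term k
| MuSucc : mu_term 1
| MuProj k : 'I_k -> mu_term k
| MuComp m k : mu_term m -> ('I_m -> mu_term k) -> mu_term k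
| MuRec k : mu_term k -> mu_term k.+2 -> mu_term k.+1
| MuMin k : mu_term k.+1 -> mu_term k.

(** [mu_eval p x y]: the partial recursive function denoted by [p] is defined
    at [x] with value [y]. In the [MuRec] case [h] lists the successive values
    of the recursion; in the [MuMin] case all values before the first zero
    must be defined. *)
Fixpoint mu_eval k (p : mu_term k) : k.-tuple nat -> nat -> Prop :=
  match p in mu_term k return k.-tuple nat -> nat -> Prop with
  | MuZero _ => fun _ y => y = 0
  | MuSucc => fun x y => y = (thead x).+1
  | MuProj _ i => fun x y => y = tnth x i
  | MuComp m _ f g => fun x y =>
      exists2 z : m.-tuple nat,
        forall i, mu_eval (g i) x (tnth z i) & mu_eval f z y
  | MuRec k f g => fun x y =>
      let x' : k.-tuple nat := [tuple of behead x] in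
      exists h : nat -> nat,
        [/\ mu_eval f x' (h 0),
            forall i, i < thead x ->
              mu_eval g [tuple of i :: h i :: x'] (h i.+1)
          & y = h (thead x)]
  | MuMin _ f => fun x y =>
      mu_eval f [tuple of y :: x] 0 /\
      forall z, z < y -> exists v, mu_eval f [tuple of z :: x] v.+1
  end.

Definition computable k (f : nfun k) : Prop :=
  exists p : mu_term k, forall x, mu_eval p x (f x).

(** A single computable [U], applied to an index and a code of the argument
    list, enumerates the members of the class uniformly in the arity. *)
Definition effectively_enumerable (C : fclass) : Prop :=
  exists2 U : nfun 2, computable U &
    forall k (f : nfun k),
      C k f <-> exists e, forall x, f x = U [tuple e; CodeSeq.code x].

Definition subrecursive (C : fclass) : Prop :=
  (forall k (f : nfun k), C k f -> computable f) /\ effectively_enumerable C.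

(** Cantor pairing: (x + y)(x + y + 1)/2 + y. *)
Definition cantor_pair (x y : nat) : nat := 'C((x + y).+1, 2) + y.

Definition int_code (z : int) : nat :=
  match z with Posz n => n.*2 | Negz n => n.*2.+1 end.

Definition rat_code (q : rat) : nat :=
  cantor_pair (int_code (numq q)) `|denq q|%N.

Definition cut_in (C : fclass) (D : rat -> bool) : Prop :=
  exists2 F : nfun 1, C 1 F &
    forall q, F [tuple rat_code q] = nat_of_bool (D q).

Definition ratfun_in (C : fclass) (T : rat -> rat) : Prop :=
  exists2 F : nfun 1, C 1 F &
    forall q, F [tuple rat_code q] = rat_code (T q).

Definition natratfun2_in (C : fclass) (G : nat -> nat -> rat) : Prop :=
  exists2 F : nfun 2, C 2 F &
    forall b n, F [tuple b; n] = rat_code (G b n).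

Local Open Scope classical_set_scope.
Local Open Scope ring_scope.

Section Representations.
Variable R : realType.

(** The values 0 and 1 of a Dedekind cut are [false] and [true]. *)
Definition dedekind_cut (beta : R) (D : rat -> bool) : Prop :=
  forall q : rat, D q = false <-> ratr q < beta.

Definition trace_below (alpha : R) (T : rat -> rat) : Prop :=
  forall q : rat, ratr q < alpha -> q < T q /\ ratr (T q) < alpha.

Definition trace_above (alpha : R) (T : rat -> rat) : Prop :=
  forall q : rat, alpha < ratr q -> alpha < ratr (T q) /\ T q < q.

(** The digits [D i] and positions [k i] are relevant for [i >= 1] only.
    For irrational [alpha] in (0, 1) and [b >= 2] exactly one [A] satisfies
    this. *)
Definition sum_approx_below (alpha : R) (b : nat) (A : nat -> rat) : Prop :=
  exists D k : nat -> nat,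
    [/\ forall i, (0 < i)%N -> (0 < D i < b)%N,
        (0 < k 1)%N /\ forall i, (0 < i)%N -> (k i < k i.+1)%N,
        (\sum_(1 <= i < n.+1) (D i)%:R / b%:R ^+ k i : R) @[n --> \oo]
          --> alpha,
        A 0%N = 0
      & forall i, (0 < i)%N -> A i = (D i)%:R / b%:R ^+ k i].

Definition sum_approx_above (alpha : R) (b : nat) (A : nat -> rat) : Prop :=
  sum_approx_below (1 - alpha) b A.

Definition general_sum_approx_below (alpha : R) (G : nat -> nat -> rat) : Prop :=
  (forall b, (2 <= b)%N -> sum_approx_below alpha b (G b)) /\
  (forall b n, (b < 2)%N -> G b n = 0).

Definition general_sum_approx_above (alpha : R) (G : nat -> nat -> rat) : Prop :=
  (forall b, (2 <= b)%N -> sum_approx_above alpha b (G b)) /\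
  (forall b n, (b < 2)%N -> G b n = 0).

Definition irrational01 : set R := [set alpha | irrational alpha /\ 0 < alpha < 1].

Definition class_D (C : fclass) : set R :=
  [set alpha | irrational01 alpha /\
    exists2 D, dedekind_cut alpha D & cut_in C D].

Definition class_T_below (C : fclass) : set R :=
  [set alpha | irrational01 alpha /\
    exists2 T, trace_below alpha T & ratfun_in C T].

Definition class_T_above (C : fclass) : set R :=
  [set alpha | irrational01 alpha /\
    exists2 T, trace_above alpha T & ratfun_in C T].

Definition class_g_below (C : fclass) : set R :=
  [set alpha | irrational01 alpha /\
    exists2 G, general_sum_approx_below alpha G & natratfun2_in C G].

Definition class_g_above (C : fclass) : set R :=
  [set alpha | irrational01 alpha /\
    exists2 G, general_sum_approx_above alpha G & natratfun2_in C G].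

End Representations.

(* Main.v *)
Require Import Defs.
From mathcomp Require Import all_boot all_order all_algebra.
From mathcomp Require Import all_classical all_reals all_analysis.
From mathcomp Require Import zify ring lra.
Set Implicit Arguments.
Unset Strict Implicit.
Unset Printing Implicit Defensive.
Import Order.TTheory GRing.Theory Num.Theory.
Import numFieldNormedType.Exports.
Local Open Scope classical_set_scope.

(** Write [d] for the denominator of a rational [q].  In base [2 d] the number
    [q] has a single fractional digit, so [q < alpha] iff [q <= G (2 d) 1]; this
    computes a Dedekind cut from a general sum approximation [G], and
    [G (2 d) 1 + G (2 d) 2] is a trace function.  Conversely, let [s] be a partial
    sum of the base [b] expansion.  Since [T s - s] is at least [1 / K], where [K]
    is the product of the denominators of [s] and [T s], and [K < b ^ K], the next
    nonzero digit occurs at a position at most [K]; a bounded search with the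
    Dedekind cut finds it.  Approximations from above reduce to those from below
    through [q |-> 1 - q]. *)

(** * Primitive recursive functions *)

Definition tail k (y : k.+1.-tuple nat) : k.-tuple nat := [tuple of behead y].

Implicit Types C : fclass.

Local Notation PR C := (@primrec_in C _).

(** [PR_comp] only accepts a literal tuple of component functions. A tuple-valued map equals the
    tuple of its components, so arguments of any shape are covered. *)
Lemma PR_subst C k m (f : nfun m) (t : k.-tuple nat -> m.-tuple nat) :
  PR C f -> (forall i, PR C (fun x => tnth (t x) i)) -> PR C (fun x => f (t x)).
Proof.
move=> hf ht; have := PR_comp hf ht; congr primrec_in; apply/funext => x.
by congr f; apply: eq_from_tnth => i; rewrite tnth_mktuple.
Qed.

Lemma PR_tail C k m (t : k.-tuple nat -> m.+1.-tuple nat) :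
  (forall i, PR C (fun x => tnth (t x) i)) ->
  forall i, PR C (fun x => tnth (tail (t x)) i).
Proof.
move=> ht i; have := ht (lift ord0 i); congr primrec_in; apply/funext => x.
by rewrite /tail tnth_behead; congr tnth; apply: val_inj; rewrite /= inordK ?ltnS.
Qed.

Lemma PR_thead C k m (t : k.-tuple nat -> m.+1.-tuple nat) :
  (forall i, PR C (fun x => tnth (t x) i)) -> PR C (fun x => thead (t x)).
Proof. exact. Qed.

Lemma PR_cons C k m (h : nfun k) (t : k.-tuple nat -> m.-tuple nat) :
  PR C h -> (forall i, PR C (fun x => tnth (t x) i)) ->
  forall i, PR C (fun x => tnth [tuple of h x :: t x] i).
Proof.
move=> hh ht i; case: (unliftP ord0 i) => [j|] ->.
  by have := ht j; congr primrec_in; apply/funext => x; rewrite tnthS.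
by move: hh; congr primrec_in; apply/funext => x; rewrite tnth0.
Qed.

Lemma PR_nil C k (t : k.-tuple nat -> 0.-tuple nat) i : PR C (fun x => tnth (t x) i).
Proof. by case: i. Qed.

Lemma PR_app1 C k (f : nfun 1) (g : nfun k) :
  PR C f -> PR C g -> PR C (fun x => f [tuple g x]).
Proof.
move=> hf hg; apply: (PR_subst hf) => i.
have := PR_cons hg (@PR_nil C k (fun=> [tuple])) i; congr primrec_in.
Qed.

Lemma PR_app2 C k (f : nfun 2) (g h : nfun k) :
  PR C f -> PR C g -> PR C h -> PR C (fun x => f [tuple g x; h x]).
Proof.
move=> hf hg hh; apply: (PR_subst hf) => i.
have := PR_cons hg (PR_cons hh (@PR_nil C k (fun=> [tuple]))) i; congr primrec_in.
Qed.

Lemma PR_S C k (g : nfun k) : PR C g -> PR C (fun x => (g x).+1).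
Proof. exact: (PR_app1 (PR_succ C)). Qed.

Lemma PR_const C k c : PR C (fun _ : k.-tuple nat => c).
Proof. by elim: c => [|c IH]; [exact: PR_zero | exact: PR_S]. Qed.

(** Lets recursions be written with [nat_rect] and a curried step; the tuple [y] holds the counter,
    the previous value and the parameters, in this order. *)
Lemma PR_natrec C k (n f : nfun k) (g : nat -> nat -> nfun k) :
  PR C n -> PR C f ->
  PR C (fun y : k.+2.-tuple nat => g (thead y) (thead (tail y)) (tail (tail y))) ->
  PR C (fun x => nat_rect (fun=> nat) (f x) (fun m r => g m r x) (n x)).
Proof.
move=> hn hf hg.
have := PR_subst (PR_rec hf hg) (PR_cons hn (fun i => PR_proj C i)).
congr primrec_in; apply/funext => x; rewrite theadE.
have -> : [tuple of behead [tuple of n x :: x]] = x by apply: val_inj.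
elim: (n x) => //= m ->; congr g.
by rewrite /tail; apply: val_inj.
Qed.

#[local] Hint Resolve PR_const PR_proj PR_nil PR_tail PR_thead PR_S : primrec.
(* Serves goals where an assumed function is applied to a rearranged tuple such as [tail y]. *)
#[local] Hint Extern 2 (primrec_in _ (fun x => ?f _)) =>
  is_var f; simple apply (@PR_subst _ _ _ f) : primrec.

Ltac PR_auto := by auto 50 with primrec nocore.

Lemma PR_eq C k (f g : nfun k) : f =1 g -> PR C f -> PR C g.
Proof. by move/funext ->. Qed.

Lemma PR_pred C k (f : nfun k) : PR C f -> PR C (fun x => (f x).-1).
Proof.
move=> hf; apply: (PR_eq _ (@PR_natrec C k f (fun=> 0) (fun m _ _ => m) _ _ _)).
- by move=> x; case: (f x).
- PR_auto.
- PR_auto.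
- PR_auto.
Qed.
#[local] Hint Resolve PR_pred : primrec.

Lemma PR_addn C k (f g : nfun k) :
  PR C f -> PR C g -> PR C (fun x => f x + g x).
Proof.
move=> hf hg.
apply: (PR_eq _ (@PR_natrec C k f g (fun _ r _ => r.+1) _ _ _)); try PR_auto.
by move=> x /=; elim: (f x) => //= m ->.
Qed.
#[local] Hint Resolve PR_addn : primrec.

Lemma PR_muln C k (f g : nfun k) :
  PR C f -> PR C g -> PR C (fun x => f x * g x).
Proof.
move=> hf hg.
apply: (PR_eq _ (@PR_natrec C k f (fun=> 0) (fun _ r x => g x + r) _ _ _)); 
 try PR_auto.
by move=> x /=; elim: (f x) => //= m ->; rewrite mulSn.
Qed.
#[local] Hint Resolve PR_muln : primrec.

Lemma PR_subn C k (f g : nfun k) :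
  PR C f -> PR C g -> PR C (fun x => f x - g x).
Proof.
move=> hf hg.
apply: (PR_eq _ (@PR_natrec C k g f (fun _ r _ => r.-1) _ _ _)); try PR_auto.
by move=> x /=; elim: (g x) => [|m /= ->]; rewrite ?subn0 ?subnS.
Qed.
#[local] Hint Resolve PR_subn : primrec.

Lemma PR_expn C k (f g : nfun k) :
  PR C f -> PR C g -> PR C (fun x => f x ^ g x).
Proof.
move=> hf hg.
apply: (PR_eq _ (@PR_natrec C k g (fun=> 1) (fun _ r x => f x * r) _ _ _));
  try PR_auto.
by move=> x /=; elim: (g x) => [|m /= ->]; rewrite ?expnS.
Qed.
#[local] Hint Resolve PR_expn : primrec.

Lemma PR_leq C k (f g : nfun k) :
  PR C f -> PR C g -> PR C (fun x => nat_of_bool (f x <= g x)).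
Proof.
move=> hf hg; apply: (@PR_eq _ _ (fun x => 1 - (f x - g x))); last PR_auto.
by move=> x; case: leqP; lia.
Qed.
#[local] Hint Resolve PR_leq : primrec.

Lemma PR_andb C k (P Q : k.-tuple nat -> bool) :
  PR C (fun x => nat_of_bool (P x)) -> PR C (fun x => nat_of_bool (Q x)) ->
  PR C (fun x => nat_of_bool (P x && Q x)).
Proof.
move=> hP hQ.
apply: (@PR_eq _ _ (fun x => P x * Q x)); last by apply: PR_muln.
by move=> x; rewrite mulnb.
Qed.
#[local] Hint Resolve PR_andb : primrec.

Lemma PR_negb C k (P : k.-tuple nat -> bool) :
  PR C (fun x => nat_of_bool (P x)) -> PR C (fun x => nat_of_bool (~~ P x)).
Proof.
move=> hP; apply: (@PR_eq _ _ (fun x => 1 - P x)); last PR_auto.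
by move=> x; case: (P x).
Qed.
#[local] Hint Resolve PR_negb : primrec.

Lemma PR_eqn C k (f g : nfun k) :
  PR C f -> PR C g -> PR C (fun x => nat_of_bool (f x == g x)).
Proof.
move=> hf hg.
apply: (@PR_eq _ _ (fun x => (f x <= g x) && (g x <= f x))); last PR_auto.
by move=> x; rewrite eqn_leq.
Qed.
#[local] Hint Resolve PR_eqn : primrec.

Lemma PR_if C k (P : k.-tuple nat -> bool) (f g : nfun k) :
  PR C (fun x => nat_of_bool (P x)) -> PR C f -> PR C g ->
  PR C (fun x => if P x then f x else g x).
Proof.
move=> hP hf hg.
apply: (@PR_eq _ _ (fun x => P x * f x + (1 - P x) * g x)); last PR_auto.
by move=> x; case: (P x); rewrite ?mul1n ?mul0n ?addn0 ?add0n.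
Qed.
#[local] Hint Resolve PR_if : primrec.

Lemma PR_odd C k (f : nfun k) : PR C f -> PR C (fun x => nat_of_bool (odd (f x))).
Proof.
move=> hf.
apply: (PR_eq _ (@PR_natrec C k f (fun=> 0) (fun _ r _ => 1 - r) _ _ _));
  try PR_auto.
by move=> x /=; elim: (f x) => //= m ->; case: odd.
Qed.
#[local] Hint Resolve PR_odd : primrec.

Lemma PR_half C k (f : nfun k) : PR C f -> PR C (fun x => (f x)./2).
Proof.
move=> hf.
apply: (PR_eq _ (@PR_natrec C k f (fun=> 0) (fun m r _ => odd m + r) _ _ _));
  try PR_auto.
by move=> x /=; elim: (f x) => //= m ->; rewrite uphalf_half.
Qed.
#[local] Hint Resolve PR_half : primrec.

(** * Bounded search, division and greatest common divisors *)

Lemma find_iotaP (P : pred nat) n i : i < n -> P i ->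
  let r := find P (iota 0 n) in
  [/\ r < n, r <= i, P r & forall j, j < r -> ~~ P j].
Proof.
move=> lin Pi /=; set r := find _ _.
have hP : has P (iota 0 n) by apply/hasP; exists i; rewrite ?mem_iota.
have rn : r < n by rewrite /r; move: hP; rewrite has_find size_iota.
have before j : j < r -> ~~ P j.
  move=> jr; have := before_find 0 jr.
  by rewrite nth_iota ?(ltn_trans jr)// => ->.
split=> //; last by have := nth_find 0 hP; rewrite nth_iota.
by rewrite leqNgt; apply/negP => /before; rewrite Pi.
Qed.

Lemma find_iota_uniq (P : pred nat) n i : i < n -> P i ->
  (forall j, j < i -> ~~ P j) -> find P (iota 0 n) = i.
Proof.
move=> lin Pi hi; have [_ + Pr _] := find_iotaP lin Pi.
by rewrite leq_eqVlt => /orP[/eqP//|/hi]; rewrite Pr.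
Qed.

Lemma PR_find C k (n : nfun k) (P : nat -> k.-tuple nat -> bool) : PR C n ->
  PR C (fun y : k.+1.-tuple nat => nat_of_bool (P (thead y) (tail y))) ->
  PR C (fun x => find (fun i => P i x) (iota 0 (n x))).
Proof.
move=> hn hP.
(* After [m] rounds the accumulator is the least witness below [m], or [m] if there is none; a value
   [r < m] is therefore final. *)
apply: (PR_eq _ (@PR_natrec C k n (fun=> 0)
  (fun m r x => if r < m then r else m + ~~ P m x) _ _ _)); try PR_auto.
  move=> x; elim: (n x) => // m IH; rewrite [LHS]/= [X in X < _]IH IH.
  rewrite -[in RHS]addn1 iotaD find_cat has_find size_iota add0n /=.
  by case: ifP => // _; case: (P m x); rewrite /= ?addn0 ?addn1.
have hP' := PR_subst hP (PR_cons (PR_thead (@PR_proj C k.+2))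
  (PR_tail (PR_tail (@PR_proj C k.+2)))).
have {hP'}: PR C (fun y : k.+2.-tuple nat => nat_of_bool (P (thead y) (tail (tail y)))).
  move: hP'; apply: PR_eq => y; rewrite theadE; congr (nat_of_bool (P _ _)).
  exact: val_inj.
PR_auto.
Qed.
#[local] Hint Resolve PR_find : primrec.

Lemma PR_divn C k (f g : nfun k) :
  PR C f -> PR C g -> PR C (fun x => f x %/ g x).
Proof.
move=> hf hg.
apply: (@PR_eq _ _ (fun x => if g x == 0 then 0 else
  find (fun q => f x < q.+1 * g x) (iota 0 (f x).+1))); last PR_auto.
move=> x; case: eqP => [->|/eqP]; rewrite ?divn0// -lt0n => g0.
apply: find_iota_uniq; first by rewrite ltnS leq_div.
  exact: ltn_ceil.
by move=> j; rewrite leq_divRL// -leqNgt.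
Qed.
#[local] Hint Resolve PR_divn : primrec.

Lemma PR_dvdn C k (f g : nfun k) :
  PR C f -> PR C g -> PR C (fun x => nat_of_bool (f x %| g x)).
Proof.
move=> hf hg.
apply: (@PR_eq _ _ (fun x => g x %/ f x * f x == g x)); last PR_auto.
by move=> x; rewrite dvdn_eq.
Qed.
#[local] Hint Resolve PR_dvdn : primrec.

Lemma PR_gcdn C k (f g : nfun k) :
  PR C f -> PR C g -> PR C (fun x => gcdn (f x) (g x)).
Proof.
move=> hf hg; pose s x := f x + g x.
(* Candidates are tried downwards from [s x], which bounds the gcd even when one argument is zero;
   the first common divisor met is the greatest. If both arguments vanish, the result is [0]. *)
apply: (@PR_eq _ _ (fun x => s x -
  find (fun i => (s x - i %| f x) && (s x - i %| g x)) (iota 0 (s x)))); last first.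
  have hs : PR C s by rewrite /s; PR_auto.
  PR_auto.
move=> x; have [s0|s0] := posnP (s x).
  by move: s0; rewrite /s => /eqP; rewrite addn_eq0 => /andP[/eqP-> /eqP->].
have d0 : 0 < gcdn (f x) (g x) by rewrite gcdn_gt0 -addn_gt0.
have ds : gcdn (f x) (g x) <= s x.
  by apply: dvdn_leq => //; rewrite dvdn_add ?dvdn_gcdl ?dvdn_gcdr.
rewrite (@find_iota_uniq _ _ (s x - gcdn (f x) (g x))) ?subKn//.
- lia.
- by rewrite dvdn_gcdl dvdn_gcdr.
- move=> j jlt; rewrite -dvdn_gcd; apply/negP => /(dvdn_leq d0); lia.
Qed.
#[local] Hint Resolve PR_gcdn : primrec.

(** * Codes of pairs and rationals *)

(** The first code on the diagonal [x + y + 1] exceeds the first code on the diagonal [x + y] by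
    [x + y + 1], more than the summand [y] can add. *)
Lemma cantor_pair_lt x y x' y' :
  x + y < x' + y' -> cantor_pair x y < cantor_pair x' y'.
Proof.
move=> h; rewrite /cantor_pair.
have : 'C((x + y).+2, 2) <= 'C((x' + y').+1, 2) by rewrite leq_bin2l.
rewrite binS bin1; lia.
Qed.

Lemma cantor_pair_inj x y x' y' :
  cantor_pair x y = cantor_pair x' y' -> x = x' /\ y = y'.
Proof.
move=> e; have es : x + y = x' + y'.
  by case: (ltngtP (x + y) (x' + y')) => // /cantor_pair_lt; rewrite e ltnn.
by move: e; rewrite /cantor_pair es; lia.
Qed.

Lemma leq_cantor_pair x y : x <= cantor_pair x y /\ y <= cantor_pair x y.
Proof. rewrite /cantor_pair binS bin1; lia. Qed.

(** The inner search stays below its bound [c.+1] exactly when some [y] completes the pair. *)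
Definition unpair1 c := find
  (fun x => find (fun y => cantor_pair x y == c) (iota 0 c.+1) < c.+1)
  (iota 0 c.+1).

Definition unpair2 c :=
  find (fun y => cantor_pair (unpair1 c) y == c) (iota 0 c.+1).

Lemma cantor_pairK1 x y : unpair1 (cantor_pair x y) = x.
Proof.
have [hx hy] := leq_cantor_pair x y.
apply: find_iota_uniq; rewrite ?ltnS//.
  by have [] := @find_iotaP (fun j => cantor_pair x j == cantor_pair x y)
    (cantor_pair x y).+1 y _ (eqxx _).
move=> j jx; rewrite -[X in _ < X](size_iota 0 (cantor_pair x y).+1) -has_find.
apply/hasPn => i _; apply/eqP => /cantor_pair_inj[e _].
by rewrite e ltnn in jx.
Qed.

Lemma cantor_pairK2 x y : unpair2 (cantor_pair x y) = y.
Proof.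
have [hx hy] := leq_cantor_pair x y.
rewrite /unpair2 cantor_pairK1; apply: find_iota_uniq; rewrite ?ltnS//.
by move=> j jy; apply/eqP => /cantor_pair_inj[_ e]; rewrite e ltnn in jy.
Qed.

Lemma PR_cantor_pair C k (f g : nfun k) :
  PR C f -> PR C g -> PR C (fun x => cantor_pair (f x) (g x)).
Proof.
move=> hf hg.
apply: (@PR_eq _ _ (fun x => ((f x + g x).+1 * (f x + g x))./2 + g x)).
  by move=> x; rewrite /cantor_pair bin2.
PR_auto.
Qed.
#[local] Hint Resolve PR_cantor_pair : primrec.

Lemma PR_unpair1 C k (f : nfun k) : PR C f -> PR C (fun x => unpair1 (f x)).
Proof. by move=> hf; rewrite /unpair1; PR_auto. Qed.
#[local] Hint Resolve PR_unpair1 : primrec.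

Lemma PR_unpair2 C k (f : nfun k) : PR C f -> PR C (fun x => unpair2 (f x)).
Proof. by move=> hf; rewrite /unpair2; PR_auto. Qed.
#[local] Hint Resolve PR_unpair2 : primrec.

#[local] Hint Extern 2 (primrec_in _ (fun x => rat_code (?q _))) =>
  is_var q; simple apply (@PR_subst _ _ _ (fun x => rat_code (q x))) : primrec.

Lemma PR_absz_denq C k (q : k.-tuple nat -> rat) :
  PR C (fun x => rat_code (q x)) -> PR C (fun x => absz (denq (q x))).
Proof.
move=> hq; apply: (@PR_eq _ _ (fun x => unpair2 (rat_code (q x)))); last PR_auto.
by move=> x; rewrite cantor_pairK2.
Qed.
#[local] Hint Resolve PR_absz_denq : primrec.

Lemma PR_int_code_numq C k (q : k.-tuple nat -> rat) :
  PR C (fun x => rat_code (q x)) -> PR C (fun x => int_code (numq (q x))).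
Proof.
move=> hq; apply: (@PR_eq _ _ (fun x => unpair1 (rat_code (q x)))); last PR_auto.
by move=> x; rewrite cantor_pairK1.
Qed.
#[local] Hint Resolve PR_int_code_numq : primrec.

Lemma PR_absz_numq C k (q : k.-tuple nat -> rat) :
  PR C (fun x => rat_code (q x)) -> PR C (fun x => absz (numq (q x))).
Proof.
move=> hq.
(* [Negz n] has code [2 n + 1] and absolute value [n + 1], so the parity bit is added to half the
   code. *)
apply: (@PR_eq _ _ (fun x => odd (int_code (numq (q x)))
                             + (int_code (numq (q x)))./2)); last PR_auto.
by move=> x; case: (numq _) => n /=; rewrite ?odd_double ?uphalf_double ?doubleK.
Qed.
#[local] Hint Resolve PR_absz_numq : primrec.

Local Open Scope ring_scope.

Lemma natr_numq_denq (q : rat) : 0 <= q ->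
  q = (absz (numq q))%:R / (absz (denq q))%:R.
Proof.
move=> q0; rewrite -{1}[q]divq_num_den !natr_absz.
by rewrite ger0_norm ?numq_ge0// gtr0_norm.
Qed.

(** Cancelling the gcd gives the reduced fraction, and doubling its numerator is [int_code] on
    nonnegative integers. For [d = 0] the code is that of the rational [0], in accordance with the
    convention [x / 0 = 0]. *)
Definition frac_code (a d : nat) : nat :=
  if d == 0%N then cantor_pair 0 1 else
  cantor_pair (a %/ gcdn a d + a %/ gcdn a d) (d %/ gcdn a d).

Lemma frac_codeE a d : frac_code a d = rat_code (a%:R / d%:R).
Proof.
rewrite /frac_code; case: (posnP d) => [->|d0]; first by rewrite invr0 mulr0.
set g := gcdn a d.
have g0 : (0 < g)%N by rewrite gcdn_gt0 d0 orbT.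
have [ga gd] : (g %| a /\ g %| d)%N by rewrite dvdn_gcdl dvdn_gcdr.
have d'0 : (0 < d %/ g)%N by rewrite divn_gt0// dvdn_leq.
have cop : coprime (a %/ g) (d %/ g).
  rewrite /coprime -(eqn_pmul2r g0) muln_gcdl !divnK//; lia.
have -> : a%:R / d%:R = (Posz (a %/ g))%:~R / (Posz (d %/ g))%:~R :> rat.
  rewrite -[in LHS](divnK ga) -[in LHS](divnK gd) !natrM -mulf_div divff ?mulr1//.
  by rewrite pnatr_eq0 -lt0n.
rewrite /rat_code coprimeq_num// coprimeq_den//.
rewrite eqz_nat gtn_eqF// gtr0_sg// mul1r /=.
by rewrite addnn.
Qed.

Lemma PR_frac C k (a d : nfun k) : PR C a -> PR C d ->
  PR C (fun x => rat_code ((a x)%:R / (d x)%:R)).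
Proof.
move=> ha hd; apply: (@PR_eq _ _ (fun x => frac_code (a x) (d x))).
  by move=> x; rewrite frac_codeE.
by rewrite /frac_code; PR_auto.
Qed.
#[local] Hint Resolve PR_frac : primrec.

Lemma PR_addq C k (q r : k.-tuple nat -> rat) :
  (forall x, 0 <= q x) -> (forall x, 0 <= r x) ->
  PR C (fun x => rat_code (q x)) -> PR C (fun x => rat_code (r x)) ->
  PR C (fun x => rat_code (q x + r x)).
Proof.
move=> q0 r0 hq hr; pose n (q : rat) := absz (numq q).
pose d (q : rat) := absz (denq q).
apply: (@PR_eq _ _ (fun x => rat_code (
  (n (q x) * d (r x) + n (r x) * d (q x))%N%:R / (d (q x) * d (r x))%N%:R))).
  move=> x; congr rat_code.
  rewrite [q x in RHS]natr_numq_denq// [r x in RHS]natr_numq_denq//.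
  by rewrite addf_div ?natrD ?natrM// pnatr_eq0 absz_eq0 denq_neq0.
by rewrite /n /d; PR_auto.
Qed.

(** Only [r] is required to be nonnegative, since the cut is asked about arbitrary rationals [q]. A
    negative [q] shows in the odd code of its numerator, and then the comparison is true. *)
Lemma PR_leq_rat C k (q r : k.-tuple nat -> rat) : (forall x, 0 <= r x) ->
  PR C (fun x => rat_code (q x)) -> PR C (fun x => rat_code (r x)) ->
  PR C (fun x => nat_of_bool (q x <= r x)).
Proof.
move=> r0 hq hr; pose n (q : rat) := absz (numq q).
pose d (q : rat) := absz (denq q).
apply: (@PR_eq _ _ (fun x => if odd (int_code (numq (q x))) then 1%N else
  (n (q x) * d (r x) <= n (r x) * d (q x))%N : nat)); last first.
  by rewrite /n /d; PR_auto.
move=> x; case: ifPn => h.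
  have q0 : q x < 0.
    by rewrite -numq_lt0; move: h; case: (numq _) => //= m; rewrite odd_double.
  by rewrite (le_trans (ltW q0)).
have q0 : 0 <= q x.
  by rewrite -numq_ge0; move: h; case: (numq _) => //= m; rewrite odd_double.
rewrite [q x in RHS]natr_numq_denq// [r x in RHS]natr_numq_denq//.
have d0 (p : rat) : 0 < (d p)%:R :> rat by rewrite ltr0n absz_gt0 denq_neq0.
rewrite -/(n _) -/(d _) -/(n _) -/(d _) (ler_pdivrMr _ _ (d0 _)) mulrAC.
by rewrite (ler_pdivlMr _ _ (d0 _)) -!natrM ler_nat.
Qed.

(** As [d - n] and [d] have the same gcd as [n] and [d], reflection keeps a fraction reduced. *)
Lemma numq_1B (q : rat) : numq (1 - q) = denq q - numq q /\ denq (1 - q) = denq q.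
Proof.
have cop : coprime (absz (denq q - numq q)) (absz (denq q)).
  by have := coprime_num_den q; rewrite -!coprimezE /coprimez gcdzC
    [X in _ -> X == _]gcdzC gcdzDl gcdzN.
have -> : 1 - q = (denq q - numq q)%:~R / (denq q)%:~R.
  rewrite intrB mulrBl divff ?intr_eq0 ?denq_neq0//.
  by rewrite divq_num_den.
rewrite coprimeq_num// coprimeq_den// gtr0_sg// mul1r.
by rewrite (negPf (denq_neq0 q)) gtr0_norm.
Qed.

Lemma PR_1Bq C k (q : k.-tuple nat -> rat) :
  PR C (fun x => rat_code (q x)) -> PR C (fun x => rat_code (1 - q x)).
Proof.
move=> hq; pose n x := absz (numq (q x)); pose d x := absz (denq (q x)).
(* The branches are [q < 0], [0 <= q <= 1] and [q > 1]; in the last one the numerator [d - n] is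
   negative and has code [2 (n - d - 1) + 1]. *)
apply: (@PR_eq _ _ (fun x => cantor_pair
  (if odd (int_code (numq (q x))) then d x + n x + (d x + n x) else
   if n x <= d x then d x - n x + (d x - n x) else
   (n x - d x).-1 + (n x - d x).-1 + 1)%N (d x))); last first.
  by rewrite /n /d; PR_auto.
move=> x; rewrite /rat_code; have [-> ->] := numq_1B (q x).
congr cantor_pair; rewrite /n /d.
have : 0 < denq (q x) by [].
case: (denq _) => // e _ /=.
case: (numq _) => m /=.
  rewrite odd_double; case: leqP => h.
    by rewrite subzn//= addnn.
  have -> : Posz e - Posz m = Negz (m - e).-1 by lia.
  by rewrite /= addnn addn1.
by rewrite odd_double /= addnn.
Qed.

(* Inverts [rat_code] on nonnegative rationals. *)
Definition nneg_decode (c : nat) : rat := (unpair1 c)./2%:R / (unpair2 c)%:R.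

Lemma nneg_decode_ge0 c : 0 <= nneg_decode c.
Proof. by rewrite divr_ge0. Qed.

Lemma rat_codeK q : 0 <= q -> nneg_decode (rat_code q) = q.
Proof.
move=> q0; rewrite [RHS]natr_numq_denq// /nneg_decode cantor_pairK1 cantor_pairK2.
by move: q0; rewrite -numq_ge0; case: (numq q) => //= n _; rewrite doubleK.
Qed.

Lemma PR_nneg_decode C k (f : nfun k) :
  PR C f -> PR C (fun x => rat_code (nneg_decode (f x))).
Proof. by move=> hf; rewrite /nneg_decode; PR_auto. Qed.
#[local] Hint Resolve PR_nneg_decode : primrec.

Lemma PR_if_rat C k (P : k.-tuple nat -> bool) (q r : k.-tuple nat -> rat) :
  PR C (fun x => nat_of_bool (P x)) -> PR C (fun x => rat_code (q x)) ->
  PR C (fun x => rat_code (r x)) ->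
  PR C (fun x => rat_code (if P x then q x else r x)).
Proof.
by move=> hP hq hr; apply: (PR_eq _ (PR_if hP hq hr)) => x; case: (P x).
Qed.

(* Negation is written [q |-> 1 - (1 + q)] to reuse [PR_1Bq]. *)
Definition rat_decode (c : nat) : rat :=
  if odd (unpair1 c) then 1 - (1%:R / 1%:R + (unpair1 c)./2.+1%:R / (unpair2 c)%:R)
  else nneg_decode c.

Lemma rat_decodeK : cancel rat_code rat_decode.
Proof.
move=> q; case: (leP 0 q) => q0; rewrite /rat_decode.
  rewrite rat_codeK// cantor_pairK1.
  by move: q0; rewrite -numq_ge0; case: (numq q) => //= n _; rewrite odd_double.
rewrite cantor_pairK1 cantor_pairK2 -[RHS]divq_num_den.
move: q0; rewrite -numq_lt0; case: (numq q) => // n _.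
case: (denq q) (denq_gt0 q) => // d _.
by rewrite /= odd_double uphalf_double NegzE divr1 opprD addrA subrr sub0r mulrNz mulNr.
Qed.

Lemma PR_rat_decode C k (f : nfun k) :
  PR C f -> PR C (fun x => rat_code (rat_decode (f x))).
Proof.
move=> hf; apply: PR_if_rat; [PR_auto | | PR_auto].
apply: PR_1Bq; apply: PR_addq => [x|x||]; rewrite ?divr_ge0//; PR_auto.
Qed.

(** The recursion runs on codes. Nonnegativity is an invariant, so [nneg_decode] recovers every
    intermediate value. *)
Lemma PR_natrec_rat C k (n : nfun k) (f : k.-tuple nat -> rat)
    (g : nat -> rat -> k.-tuple nat -> rat) :
  (forall x, 0 <= f x) -> (forall m r x, 0 <= r -> 0 <= g m r x) ->
  PR C n -> PR C (fun x => rat_code (f x)) ->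
  PR C (fun y : k.+2.-tuple nat => rat_code
     (g (thead y) (nneg_decode (thead (tail y))) (tail (tail y)))) ->
  PR C (fun x => rat_code (nat_rect (fun=> rat) (f x) (fun m r => g m r x) (n x))).
Proof.
move=> f0 g0 hn hf hg.
apply: PR_eq (@PR_natrec C k n (fun x => rat_code (f x))
  (fun m c x => rat_code (g m (nneg_decode c) x)) hn hf hg) => x /=.
have ge0 m : 0 <= nat_rect (fun=> rat) (f x) (fun m r => g m r x) m.
  by elim: m => [|m IH] /=; [exact: f0 | exact: g0].
by elim: (n x) => //= m ->; rewrite rat_codeK.
Qed.

(** * Sum approximations and primitive recursive digits *)

Section SumApproximation.
Variables (R : realType) (alpha : R) (b : nat) (A : nat -> rat).
Hypotheses (b2 : (2 <= b)%N) (hA : sum_approx_below alpha b A).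

Let b_gt0 : 0 < b%:R :> R. Proof. by rewrite ltr0n (ltn_trans _ b2). Qed.

(** For the last bound: the terms after the first add at most [b ^- k 1], which leaves no room for a
    multiple of [1 / b] strictly between the first term and [alpha]. *)
Lemma sum_approx_below_bounds :
  [/\ 0 <= A 1%N, 0 < A 2%N, ratr (A 1%N + A 2%N) < alpha &
      forall a : int, a%:~R / b%:R < alpha -> a%:~R / b%:R <= A 1%N].
Proof.
case: hA => D [k [hD [k1 hk] cvs _ hAD]].
pose s n : R := \sum_(1 <= i < n.+1) (D i)%:R / b%:R ^+ k i.
have sS n : s n.+1 = s n + (D n.+1)%:R / b%:R ^+ k n.+1.
  by rewrite /s big_nat_recr.
have Apos i : (0 < i)%N -> 0 < A i.
  move=> i0; rewrite hAD// divr_gt0 ?exprn_gt0 ?ltr0n ?(ltn_trans _ b2)//.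
  by case/andP: (hD i i0).
have ratrA i : (0 < i)%N -> ratr (A i) = (D i)%:R / b%:R ^+ k i :> R.
  by move=> i0; rewrite hAD// fmorph_div rmorphXn /= !ratr_nat.
have s_lt n : s n < s n.+1.
  by rewrite sS ltrDl -ratrA// ltr0q Apos.
have s_alpha n : s n < alpha.
  apply: lt_le_trans (s_lt n) _.
  have -> : alpha = limn s by apply/esym/cvg_lim.
  apply: nondecreasing_cvgn_le; last by apply/cvg_ex; exists alpha.
  by apply/nondecreasing_seqP => m; apply/ltW.
(* The upper estimate [s n + b ^- k n] does not increase with [n >= 1]: as [D + 1 <= b], a term
   together with its own unit is at most [b ^ (1 - k n.+2) <= b ^- k n.+1]. *)
have tail_le n : s n.+1 + (b%:R ^+ k n.+1)^-1 <= s 1%N + (b%:R ^+ k 1%N)^-1.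
  elim: n => [//|n IH]; apply: le_trans IH.
  rewrite sS -addrA lerD2l -[X in _ + X]mul1r -mulrDl natr1.
  have /andP[_ Db] := hD n.+2 isT.
  apply: (@le_trans _ _ (b%:R / b%:R ^+ k n.+2)).
    by rewrite ler_pM2r ?invr_gt0 ?exprn_gt0// ler_nat.
  have := hk n.+1 isT; rewrite -(ltn_predK (hk n.+1 isT)) ltnS => kk.
  rewrite exprS invfM mulrA divff ?mul1r ?gt_eqF//.
  rewrite lef_pV2 ?posrE ?exprn_gt0// ler_eXn2l ?ltr1n//.
have alpha_le : alpha <= s 1%N + (b%:R ^+ k 1%N)^-1.
  have -> : alpha = limn s by apply/esym/cvg_lim.
  apply: limr_le; first by apply/cvg_ex; exists alpha.
  apply: nearW => -[|n];
    first by rewrite (le_trans (ltW (s_lt 0%N)))// lerDl invr_ge0 exprn_ge0// ltW.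
  by apply: le_trans (tail_le n); rewrite lerDl invr_ge0 exprn_ge0// ltW.
have s1 : s 1%N = ratr (A 1%N) by rewrite /s big_nat1 ratrA.
split; rewrite ?Apos// ?ltW ?Apos//.
  by rewrite rmorphD /= -s1 ratrA// -sS.
(* Multiplied by [b ^ k 1], the inequality becomes [a * b ^ (k 1 - 1) < D 1 + 1] between integers,
   because [k 1] is positive; hence [a * b ^ (k 1 - 1) <= D 1]. *)
move=> a /lt_le_trans/(_ alpha_le); rewrite s1 ratrA//.
rewrite -[X in _ + X]mul1r -mulrDl natr1 hAD//; move: k1; case: (k 1%N) => // m _.
have bq0 : 0 < b%:R :> rat by rewrite ltr0n (ltn_trans _ b2).
rewrite ltr_pdivrMr// mulrAC ltr_pdivlMr ?exprn_gt0// exprS mulrCA.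
rewrite [X in _ < X]mulrC ltr_pM2l// -natrX pmulrn -intrM.
rewrite [in X in _ < X]pmulrn ltr_int => h.
rewrite ler_pdivrMr// mulrAC ler_pdivlMr ?exprn_gt0// exprS mulrCA.
rewrite [X in _ <= X]mulrC ler_pM2l// -natrX.
rewrite [in X in X <= _]pmulrn -intrM [in X in _ <= X]pmulrn ler_int.
by move: h; lia.
Qed.
End SumApproximation.

(** * Greedy expansion from a Dedekind cut and a trace function *)

Section Greedy.
Variables (D : rat -> bool) (T : rat -> rat) (b : nat).

(** The cut is [false] below [alpha], so this is the first position where a unit can be added to [s]
    without passing [alpha]. The bound, itself included in the search, is justified by
    [trace_below_gap]. *)
Definition greedy_pos (s : rat) : nat :=
  find (fun k => ~~ D (s + 1%:R / (b ^ k)%:R))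
       (iota 0 (absz (denq s) * absz (denq (T s))).+1).

(** The shift to [j.+1] turns the greatest admissible digit into a least witness: the first [j]
    whose successor is too large. *)
Definition greedy_digit (s : rat) : nat :=
  find (fun j => D (s + j.+1%:R / (b ^ greedy_pos s)%:R)) (iota 0 b).

Definition greedy_term (s : rat) : rat :=
  (greedy_digit s)%:R / (b ^ greedy_pos s)%:R.

Definition greedy_sum (n : nat) : rat :=
  nat_rect (fun=> rat) 0 (fun _ s => s + greedy_term s) n.

Lemma greedy_term_ge0 s : 0 <= greedy_term s.
Proof. by rewrite divr_ge0. Qed.

Lemma greedy_sum_ge0 n : 0 <= greedy_sum n.
Proof. by elim: n => //= n IH; rewrite addr_ge0 ?greedy_term_ge0. Qed.

Variables (R : realType) (alpha : R).
Hypotheses (b2 : (2 <= b)%N) (alpha01 : irrational01 alpha).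
Hypotheses (hD : dedekind_cut alpha D) (hT : trace_below alpha T).

Let b_gt0 : (0 < b)%N. Proof. exact: ltn_trans b2. Qed.

(** Irrationality of [alpha] excludes equality, so the cut decides strict inequalities on both
    sides. *)
Lemma dedekind_cutN q : D q -> alpha < ratr q.
Proof.
move=> Dq; rewrite lt_neqAle; apply/andP; split.
  by apply/eqP => e; case: alpha01 => + _; apply; exists q.
by rewrite leNgt; apply/negP => /hD; rewrite Dq.
Qed.

(* The gap [T s - s] is a positive fraction with denominator
   [denq s * denq (T s) < b ^ (denq s * denq (T s))]. *)
Lemma trace_below_gap s : ratr s < alpha ->
  ratr (s + 1%:R / (b ^ (absz (denq s) * absz (denq (T s))))%:R) < alpha.
Proof.
move=> /hT[sT]; apply: le_lt_trans; rewrite ler_rat.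
set K := (_ * _)%N.
have KE : K%:R = (denq s * denq (T s))%:~R :> rat.
  by rewrite /K -abszM natr_absz gtr0_norm// mulr_gt0.
have K0 : 0 < K%:R :> rat by rewrite KE ltr0z mulr_gt0.
have dE (q : rat) : q * (denq q)%:~R = (numq q)%:~R.
  by rewrite -{1}[q]divq_num_den divfK// intr_eq0 denq_neq0.
have gap : 1 <= (T s - s) * K%:R.
  have : 0 < (T s - s) * K%:R by rewrite mulr_gt0// subr_gt0.
  have -> : (T s - s) * K%:R =
      (numq (T s) * denq s - numq s * denq (T s))%:~R.
    by rewrite KE !(intrB, intrM) -!dE; ring.
  by rewrite ltr0z -[1]/(1%:~R) ler_int.
rewrite -lerBrDl; apply: (@le_trans _ _ (1 / K%:R)).
  by rewrite ler_pM2l// lef_pV2 ?posrE// ?ltr0n ?expn_gt0 ?b_gt0// ler_nat ltnW//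
    ltn_expl.
by rewrite ler_pdivrMr.
Qed.

Lemma greedy_posP s : 0 <= s -> ratr s < alpha ->
  [/\ (0 < greedy_pos s)%N, ratr (s + 1%:R / (b ^ greedy_pos s)%:R) < alpha &
      forall j, (j < greedy_pos s)%N -> alpha < ratr (s + 1%:R / (b ^ j)%:R)].
Proof.
move=> s0 /trace_below_gap/hD/negbT h.
have [_ _ h1 h2] := find_iotaP (P := fun k => ~~ D (s + 1%:R / (b ^ k)%:R)) (ltnSn _) h.
have {}h1 : ratr (s + 1%:R / (b ^ greedy_pos s)%:R) < alpha by apply/hD/negbTE.
split=> //; last by move=> j /h2; rewrite negbK => /dedekind_cutN.
(* Position [0] would give [s + 1 < alpha], although [alpha < 1] and [0 <= s]. *)
rewrite lt0n; apply/eqP => e; move: h1; rewrite e expn0 divr1 rmorphD /= rmorph1.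
case: alpha01 => _ /andP[_ a1]; apply/negP; rewrite -leNgt.
by rewrite (le_trans (ltW a1))// lerDr ler0q.
Qed.

Lemma greedy_digitP s : 0 <= s -> ratr s < alpha ->
  [/\ (0 < greedy_digit s < b)%N, ratr (s + greedy_term s) < alpha &
      alpha < ratr (s + greedy_term s + 1%:R / (b ^ greedy_pos s)%:R)].
Proof.
move=> s0 /(greedy_posP s0)[p0 h1 h2].
have bE : b.-1.+1 = b by rewrite prednK.
(* The digit [b] at a position is a unit at the preceding position, which the choice of [greedy_pos]
   rejected. Hence the digit search succeeds at [b.-1] at the latest. *)
have h : D (s + b.-1.+1%:R / (b ^ greedy_pos s)%:R).
  have := h2 (greedy_pos s).-1; rewrite prednK// => /(_ (leqnn _)).
  have -> : 1%:R / (b ^ (greedy_pos s).-1)%:R = b.-1.+1%:R / (b ^ greedy_pos s)%:R :> rat.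
    rewrite bE -[in RHS](prednK p0) expnS natrM invfM mulrA divff//.
    by rewrite pnatr_eq0 -lt0n.
  by move=> lt; apply/negPn/negP => /negbTE/hD/(lt_trans lt); rewrite ltxx.
have lb : (b.-1 < b)%N by rewrite bE.
have [d1 _ d2 d3] :=
  find_iotaP (P := fun j => D (s + j.+1%:R / (b ^ greedy_pos s)%:R)) lb h.
rewrite -/(greedy_digit s) in d1 d2 d3.
(* A digit [0] would mean that one unit already passes [alpha], against [h1]. *)
have d0 : (0 < greedy_digit s)%N.
  rewrite lt0n; apply/eqP => e; move: d2; rewrite e => /dedekind_cutN.
  by move/(lt_trans h1); rewrite ltxx.
rewrite d0 d1; split=> //.
  have := d3 (greedy_digit s).-1; rewrite prednK// => /(_ (leqnn _))/negbTE/hD.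
  by [].
by move/dedekind_cutN: d2; rewrite /greedy_term -addrA -mulrDl natr1.
Qed.

Lemma greedy_sum_lt n : ratr (greedy_sum n) < alpha.
Proof.
elim: n => [|n IH]; first by rewrite /= rmorph0; case: alpha01 => _ /andP[].
by have [] := greedy_digitP (greedy_sum_ge0 n) IH.
Qed.

Lemma sum_approx_below_greedy : sum_approx_below alpha b
  (fun n => if n is m.+1 then greedy_term (greedy_sum m) else 0).
Proof.
(* Terms are counted from [1], and the [i]-th one extends the sum of the [i.-1] terms before it. *)
pose k i := greedy_pos (greedy_sum i.-1).
pose d i := greedy_digit (greedy_sum i.-1).
have pP n := greedy_posP (greedy_sum_ge0 n) (greedy_sum_lt n).
have dP n := greedy_digitP (greedy_sum_ge0 n) (greedy_sum_lt n).
have termE i : (0 < i)%N -> greedy_term (greedy_sum i.-1) = (d i)%:R / b%:R ^+ k i.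
  by rewrite /greedy_term natrX.
(* After a term at position [k i] less than [b ^- k i] is missing, whereas more than [b ^- k i.+1]
   is missing before the next term. *)
have kS i : (0 < i)%N -> (k i < k i.+1)%N.
  case: i => // i _; rewrite ltnNge; apply/negP => le.
  have [_ _ u] := dP i; have [_ l _] := pP i.+1.
  have := lt_trans l u; rewrite ltr_rat /= ltrD2l ltr_pM2l//.
  rewrite ltf_pV2 ?posrE ?ltr0n ?expn_gt0 ?b_gt0//.
  by rewrite ltr_nat ltnNge leq_exp2l// le.
have k_ge n : (n <= k n)%N.
  by elim: n => // -[|n] IH; [case: (pP 0%N) | exact: leq_ltn_trans IH (kS _ _)].
have sumE n : \sum_(1 <= i < n.+1) (d i)%:R / b%:R ^+ k i = ratr (greedy_sum n) :> R.
  elim: n => [|n IH]; first by rewrite big_geq //= rmorph0.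
  rewrite big_nat_recr//= IH rmorphD /= (termE n.+1 isT).
  by rewrite fmorph_div rmorphXn /= !ratr_nat.
exists d, k; split; last 2 first.
- by [].
- by case=> // i _; rewrite -termE.
- by move=> i i0; case: (dP i.-1).
- by split; [case: (pP 0%N) | ].
- rewrite (funext sumE).
  (* What is missing after [n] terms is at most [b ^- k n <= b ^- n] for positive [n]; for [n = 0]
     the bound is [alpha <= 1]. *)
  apply: (@squeeze_cvgr _ _ _ _ (fun n => alpha - b%:R^-1 ^+ n) (fun=> alpha)).
  + apply: nearW => n; rewrite (ltW (greedy_sum_lt n)) andbT.
    case: n => [|n].
      rewrite expr0 /= rmorph0 subr_le0.
      by case: alpha01 => _ /andP[_ /ltW].
    have [_ _ /ltW] := dP n; rewrite rmorphD /= lerBlDr => /le_trans; apply.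
    rewrite lerD2l fmorph_div /= !ratr_nat mul1r exprVn -natrX.
    by rewrite lef_pV2 ?posrE ?ltr0n ?expn_gt0 ?b_gt0// ler_nat leq_exp2l// k_ge.
  + rewrite -[X in _ --> X]subr0; apply: cvgB; first exact: cvg_cst.
    apply: cvg_expr; rewrite normfV ger0_norm// invf_lt1 ?ltr1n// ltr0n//.
  + exact: cvg_cst.
Qed.
End Greedy.

(** * Primitive recursiveness of the greedy expansion *)

Section GreedyPrimrec.
Variables (C : fclass) (D : rat -> bool) (T : rat -> rat).
Variables (FD FT : nfun 1).
Hypotheses (hFD : PR C FD) (hFT : PR C FT).
Hypothesis FDE : forall q, FD [tuple rat_code q] = nat_of_bool (D q).
Hypothesis FTE : forall q, FT [tuple rat_code q] = rat_code (T q).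

Lemma PR_cut k (q : k.-tuple nat -> rat) :
  PR C (fun x => rat_code (q x)) -> PR C (fun x => nat_of_bool (D (q x))).
Proof.
by move=> hq; apply: (PR_eq _ (PR_app1 hFD hq)) => x; rewrite FDE.
Qed.

Lemma PR_trace k (q : k.-tuple nat -> rat) :
  PR C (fun x => rat_code (q x)) -> PR C (fun x => rat_code (T (q x))).
Proof.
by move=> hq; apply: (PR_eq _ (PR_app1 hFT hq)) => x; rewrite FTE.
Qed.

Variables (k : nat) (b : nfun k) (s : k.-tuple nat -> rat).
Hypotheses (hb : PR C b) (hs : PR C (fun x => rat_code (s x))).
Hypothesis s_ge0 : forall x, 0 <= s x.

Lemma PR_greedy_pos : PR C (fun x => greedy_pos D T (b x) (s x)).
Proof.
have hT := PR_trace hs; apply: PR_find; first PR_auto.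
apply: PR_negb; apply: PR_cut; apply: PR_addq => [x|x||]; rewrite ?divr_ge0//;
  PR_auto.
Qed.

Lemma PR_greedy_digit : PR C (fun x => greedy_digit D T (b x) (s x)).
Proof.
have hpos := PR_greedy_pos; apply: PR_find; first PR_auto.
apply: PR_cut; apply: PR_addq => [x|x||]; rewrite ?divr_ge0//; first PR_auto.
apply: PR_frac; first PR_auto.
apply: PR_expn; first PR_auto.
(* Inside the search the position depends only on the parameters [tail y], not on the digit being
   tried. *)
apply: (PR_subst hpos); PR_auto.
Qed.

Lemma PR_greedy_term : PR C (fun x => rat_code (greedy_term D T (b x) (s x))).
Proof.
by have := PR_greedy_digit; have := PR_greedy_pos; rewrite /greedy_term; PR_auto.
Qed.

End GreedyPrimrec.

Lemma PR_greedy_sum C (D : rat -> bool) (T : rat -> rat) (FD FT : nfun 1)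
    (hFD : PR C FD) (hFT : PR C FT)
    (FDE : forall q, FD [tuple rat_code q] = nat_of_bool (D q))
    (FTE : forall q, FT [tuple rat_code q] = rat_code (T q))
    k (b n : nfun k) (hb : PR C b) (hn : PR C n) :
  PR C (fun x => rat_code (greedy_sum D T (b x) (n x))).
Proof.
apply: (@PR_natrec_rat C k n (fun=> 0)
  (fun _ s x => s + greedy_term D T (b x) s)) => //.
- by move=> m r x r0; rewrite addr_ge0 ?greedy_term_ge0.
- PR_auto.
(* The accumulator is here an arbitrary number, not necessarily the code of a partial sum;
   [nneg_decode] is nonnegative on all of them. *)
apply: PR_addq => [y|y||]; rewrite ?nneg_decode_ge0 ?greedy_term_ge0//.
  PR_auto.
apply: (PR_greedy_term hFD hFT FDE FTE) => [||y]; rewrite ?nneg_decode_ge0//; PR_auto.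
Qed.

(** * Equivalence of the representations from below *)

Section Pointwise.
Variables (R : realType) (C : fclass) (alpha : R).
Hypotheses (hclosed : primrec_closed C) (alpha01 : irrational01 alpha).

Lemma general_sum_approx_below_in D T :
  dedekind_cut alpha D -> cut_in C D ->
  trace_below alpha T -> ratfun_in C T ->
  exists2 G, general_sum_approx_below alpha G & natratfun2_in C G.
Proof.
move=> hD [FD /PR_oracle hFD FDE] hT [FT /PR_oracle hFT FTE].
pose term b m := greedy_term D T b (greedy_sum D T b m).
exists (fun b n => if (b < 2)%N then 0 else if n is m.+1 then term b m else 0).
  split=> [b b2|b n ->//]; rewrite ltnNge b2 /=.
  exact: (sum_approx_below_greedy b2 alpha01 hD hT).
pose b (x : 2.-tuple nat) := thead x; pose n (x : 2.-tuple nat) := thead (tail x).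
(* The predecessor replaces the match on [n]; its default value at [0] is hidden by the preceding
   test. *)
exists (fun x => if (b x < 2)%N then rat_code 0 else
  if n x == 0%N then rat_code 0 else rat_code (term (b x) (n x).-1)).
  have hb : PR C b by rewrite /b; PR_auto.
  have hn : PR C n by rewrite /n; PR_auto.
  have hterm : PR C (fun x => rat_code (term (b x) (n x).-1)).
    apply: (PR_greedy_term hFD hFT FDE FTE) => // [|x].
      by apply: (PR_greedy_sum hFD hFT FDE FTE) => //; PR_auto.
    exact: greedy_sum_ge0.
  by apply: hclosed.2; PR_auto.
move=> b' n'; have -> : b [tuple b'; n'] = b' by [].
have -> : n [tuple b'; n'] = n' by [].
by case: ifP => // _; case: n'.
Qed.

(* In base [2 d] every multiple of [1 / d] is a one-digit fraction, so it lies
   below [alpha] exactly when it does not exceed the first term. *)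
Lemma le_first_term G q : general_sum_approx_below alpha G ->
  ratr q < alpha -> q <= G (absz (denq q) + absz (denq q))%N 1%N.
Proof.
case=> hG _; set d := absz (denq q) => qa.
have d0 : (0 < d)%N by rewrite absz_gt0 denq_neq0.
(* Doubling [d] makes it an admissible base even when [q] is an integer. *)
have b2 : (2 <= d + d)%N by lia.
have [_ _ _] := sum_approx_below_bounds b2 (hG _ b2).
have qE : q = (numq q *+ 2)%:~R / (d + d)%:R.
  rewrite -{1}[q]divq_num_den /d; case: (denq q) (denq_gt0 q) => // e e0.
  rewrite [absz _]/= addnn -muln2 natrM -[numq q *+ 2]mulr_natr intrM.
  by rewrite -mulf_div divff ?mulr1.
by move/(_ (numq q *+ 2)); rewrite -qE => -> //; move: qa; rewrite {1}qE
  fmorph_div /= ratr_int ratr_nat.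
Qed.

Lemma cut_trace_below_in G :
  general_sum_approx_below alpha G -> natratfun2_in C G ->
  (exists2 T, trace_below alpha T & ratfun_in C T) /\
  (exists2 D, dedekind_cut alpha D & cut_in C D).
Proof.
move=> hG [F /PR_oracle hF FE]; pose b q := (absz (denq q) + absz (denq q))%N.
have b2 q : (2 <= b q)%N.
  have d0 : (0 < absz (denq q))%N by rewrite absz_gt0 denq_neq0.
  by rewrite /b; lia.
have bounds q := sum_approx_below_bounds (b2 q) (hG.1 _ (b2 q)).
(* [PR_addq] and [PR_leq_rat] ask for nonnegative values; only the first two terms of an expansion
   are used. *)
have G_ge0 b' i : (0 < i <= 2)%N -> 0 <= G b' i.
  have [/hG.2 -> //|b'2] := ltnP b' 2.
  have [h1 /ltW h2 _ _] := sum_approx_below_bounds b'2 (hG.1 _ b'2).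
  by case: i => [|[|[|]]].
pose q (x : 1.-tuple nat) := rat_decode (thead x).
have hq : PR C (fun x => rat_code (q x)) by apply: PR_rat_decode; PR_auto.
have hGq i : PR C (fun x => rat_code (G (b (q x)) i)).
  have hb : PR C (fun x => b (q x)) by rewrite /b; PR_auto.
  by apply: (PR_eq _ (PR_app2 hF hb (PR_const C _ i))) => x; rewrite FE.
have qE r : q [tuple rat_code r] = r by rewrite /q theadE rat_decodeK.
split.
  exists (fun q => G (b q) 1%N + G (b q) 2%N).
    move=> r ra; have [_ h2 h3 _] := bounds r; split=> //.
    by rewrite (le_lt_trans (le_first_term hG ra))// ltrDl.
  exists (fun x => rat_code (G (b (q x)) 1%N + G (b (q x)) 2%N)).
    by apply: hclosed.2; apply: PR_addq => // x; exact: G_ge0.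
  by move=> r; rewrite qE.
(* If [q] is at most the first term, it is below the sum of two terms and so below [alpha]; the
   converse is [le_first_term]. *)
exists (fun q => ~~ (q <= G (b q) 1%N)).
  move=> r; split=> [/negbFE le|ra]; last by rewrite le_first_term.
  have [_ h2 h3 _] := bounds r; apply: le_lt_trans h3.
  by rewrite ler_rat (le_trans le)// lerDl ltW.
exists (fun x => nat_of_bool (~~ (q x <= G (b (q x)) 1%N))).
  by apply: hclosed.2; apply: PR_negb; apply: PR_leq_rat => // x; exact: G_ge0.
by move=> r; rewrite qE.
Qed.

Lemma general_sum_approx_belowP :
  (exists2 T, trace_below alpha T & ratfun_in C T) /\
  (exists2 D, dedekind_cut alpha D & cut_in C D) <->
  exists2 G, general_sum_approx_below alpha G & natratfun2_in C G.
Proof.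
split=> [[[T ? ?] [D ? ?]]|[G ? ?]].
  exact: (@general_sum_approx_below_in D T).
exact: (@cut_trace_below_in G).
Qed.

End Pointwise.

(** * Reflection in [1 - alpha] *)

Section Reflection.
Variables (R : realType) (C : fclass) (hclosed : primrec_closed C).

Lemma irrational01_1B (alpha : R) : irrational01 alpha -> irrational01 (1 - alpha).
Proof.
case=> irr /andP[a0 a1]; split; last by apply/andP; split; lra.
move=> [q _ qE]; apply: irr; exists (1 - q) => //.
by rewrite rmorphB rmorph1 /= qE; ring.
Qed.

(** Values are left as natural numbers so that cuts and trace functions are both covered. *)
Let refl_in (F : nfun 1) (H : rat -> nat) :
  C F -> (forall q, F [tuple rat_code q] = H q) ->
  let F' := fun x : 1.-tuple nat => F [tuple rat_code (1 - rat_decode (thead x))] in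
  PR C F' /\ forall q, F' [tuple rat_code q] = H (1 - q).
Proof.
move=> /PR_oracle hF FE F'; split; last by move=> q; rewrite /F' theadE rat_decodeK FE.
by apply: PR_app1 => //; apply: PR_1Bq; apply: PR_rat_decode; PR_auto.
Qed.

(** Reflection reverses the order, so the cut must also be negated; [dedekind_cutN] supplies the
    strict inequality. *)
Lemma cut_in_1B (alpha : R) : irrational01 alpha ->
  (exists2 D, dedekind_cut alpha D & cut_in C D) ->
  exists2 D, dedekind_cut (1 - alpha) D & cut_in C D.
Proof.
move=> alpha01 [D hD [F hF FE]]; exists (fun q => ~~ D (1 - q)).
  move=> q; split=> [/negbFE/(dedekind_cutN alpha01 hD)|qa].
    by rewrite rmorphB rmorph1 /=; lra.
  apply/negbF/negPn/negP => /negbTE/hD.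
  by rewrite rmorphB rmorph1 /=; lra.
have [hF' F'E] := refl_in hF FE.
exists (fun x => 1 - F [tuple rat_code (1 - rat_decode (thead x))])%N.
  by apply: hclosed.2; apply: PR_subn => //; PR_auto.
by move=> q; rewrite F'E; case: (D _).
Qed.

Let ratfun_1B T : ratfun_in C T -> ratfun_in C (fun q => 1 - T (1 - q)).
Proof.
case=> F hF FE; have [hF' F'E] := refl_in hF FE.
pose F'' x := rat_code (1 - rat_decode
  (F [tuple rat_code (1 - rat_decode (@thead 0 nat x))])).
exists F''; last by move=> q; rewrite /F'' F'E rat_decodeK.
by apply: hclosed.2; apply: PR_1Bq; apply: PR_rat_decode.
Qed.

(** Conjugating [T] with [q |-> 1 - q] swaps the two kinds of trace functions, so one witness serves
    both directions. *)
Lemma trace_in_1B (alpha : R) :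
  (exists2 T, trace_above alpha T & ratfun_in C T) <->
  exists2 T, trace_below (1 - alpha) T & ratfun_in C T.
Proof.
split=> -[T hT hC]; exists (fun q => 1 - T (1 - q)); try exact: ratfun_1B;
  move=> q qa; have := hT (1 - q); rewrite !rmorphB rmorph1 /=.
  by case=> [|h1 h2]; [lra | split; lra].
by case=> [|h1 h2]; [lra | split; lra].
Qed.

End Reflection.

Theorem theorem5 (R : realType) (C : fclass)
    (hsub : subrecursive C) (hclosed : primrec_closed C) :
  class_T_below C `&` class_D C = class_g_below C :> set R /\
  class_T_above C `&` class_D C = class_g_above C :> set R.
Proof.
split; apply/seteqP; split=> alpha.
- by move=> [[a01 hT] [_ hD]]; split=> //; apply/(general_sum_approx_belowP hclosed).
- by move=> [a01 /(general_sum_approx_belowP hclosed a01)[hT hD]].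
(* An approximation of [alpha] from above is by definition one of [1 - alpha] from below. *)
- move=> [[a01 /(trace_in_1B hclosed) hT] [_ /(cut_in_1B hclosed a01) hD]].
  split=> //; exact/(general_sum_approx_belowP hclosed (irrational01_1B a01)).
- move=> [a01 /(general_sum_approx_belowP hclosed (irrational01_1B a01))[hT hD]].
  split; split=> //; first exact/(trace_in_1B hclosed).
  (* The cut obtained is one of [1 - alpha]; a second reflection brings it back to [alpha]. *)
  by have := cut_in_1B hclosed (irrational01_1B a01) hD; rewrite opprB addrC subrK.
Qed.
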